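(* Suppose that $(X,\mathcal{E})$ and $(Y,\mathcal{F})$ are uniformly locally finite coarse spaces which are also small. If $\mathrm{C}^*_u(X)$ and $\mathrm{C}^*_u(Y)$ are rigidly isomorphic, then $X$ and $Y$ are coarsely equivalent.
   Context: Coarse structures. A coarse structure on a set $X$ is a collection $\mathcal{E}$ of subsets of $X\times X$ (called entourages) which contains the diagonal $\Delta_X=\{(x,x): x\in X\}$ and is closed under taking subsets, inverses $E^{-1}=\{(x,y):(y,x)\in E\}$, finite unions, and compositions $E\circ F=\{(x,y): \exists z\ (x,z)\in E,\ (z,y)\in F\}$; $(X,\mathcal{E})$ is a coarse space. The coarse structure generated by a family of subsets of $X\times X$ is the smallest coarse structure containing it; the family is then called a set of generators. A coarse space $(X,\mathcal{E})$ is uniformly locally finite if $\sup_{x\in X}|\{y\in X:(x,y)\in E\}|<\infty$ for all $E\in\mathcal{E}$. Smallness. Let $\mathbb{D}=\{z\in\mathbb{C}:|z|\le 1\}$ with its usual topology and give $\mathbb{D}^J$ the product topology. $\mathrm{cov}(\mathbb{D}^J)$ is the minimal cardinality of a family of nowhere dense subsets of $\mathbb{D}^J$ covering $\mathbb{D}^J$. Let $|\mathcal{E}|_{\min}$ be the minimal cardinality of a set of generators of $\mathcal{E}$. The coarse space $(X,\mathcal{E})$ is small if $\mathrm{cov}(\mathbb{D}^{X})>|\mathcal{E}|_{\min}$. Coarse maps. Let $(X,\mathcal{E})$, $(Y,\mathcal{F})$ be coarse spaces. Maps $f,g:Z\to X$ from a set $Z$ are close if $\{(f(z),g(z)): z\in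 Z\}\in\mathcal{E}$. A map $f:X\to Y$ is coarse if for all $E\in\mathcal{E}$ there is $F\in\mathcal{F}$ such that $(x,x')\in E$ implies $(f(x),f(x'))\in F$. A coarse map $f:X\to Y$ is a coarse equivalence if there is a coarse map $g:Y\to X$ such that $g\circ f$ and $f\circ g$ are close to $\mathrm{Id}_X$ and $\mathrm{Id}_Y$; in that case the spaces are coarsely equivalent. Uniform Roe algebras. For $T\in B(\ell_2(X))$ let $\mathrm{supp}(T)=\{(x,x'):\langle T\delta_x,\delta_{x'}\rangle\ne 0\}$. The uniform Roe algebra $\mathrm{C}^*_u(X)$ is the norm closure in $B(\ell_2(X))$ of $\{T\in B(\ell_2(X)): \mathrm{supp}(T)\in\mathcal{E}\}$. $\mathrm{C}^*_u(X)$ and $\mathrm{C}^*_u(Y)$ are rigidly isomorphic if there is a unitary $U\colon\ell_2(X)\to\ell_2(Y)$ such that $T\mapsto UTU^*$ is an isomorphism from $\mathrm{C}^*_u(X)$ onto $\mathrm{C}^*_u(Y)$ and $\inf_{x\in X}\sup_{y\in Y}|\langle U\delta_x,\delta_y\rangle|>0$ and $\inf_{y\in Y}\sup_{x\in X}|\langle U^*\delta_y,\delta_x\rangle|>0$. *)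

(* Defs.v *)
From HB Require Import structures.
From mathcomp Require Import all_boot all_order all_algebra.
From mathcomp Require Import ring lra.
From mathcomp Require Import complex.
From mathcomp Require Import all_classical all_reals all_analysis.
From mathcomp.analysis.showcase Require summability.

Set Implicit Arguments.
Unset Strict Implicit.
Unset Printing Implicit Defensive.

Import Order.TTheory GRing.Theory Num.Theory.
Import numFieldNormedType.Exports.
Import Normc.

Local Open Scope classical_set_scope.
Local Open Scope card_scope.
Local Open Scope ring_scope.
Local Open Scope complex_scope.

Record coarse_structure (X : Type) (E : set (set (X * X))) : Prop := {
  coarse_diagonal : E diagonal;
  coarse_sub : forall A B, E B -> A `<=` B -> E A;
  coarse_inv : forall A, E A -> E (A^-1)%relation;
  coarse_setU : forall A B, E A -> E B -> E (A `|` B);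
  coarse_comp : forall A B, E A -> E B -> E (A \; B)%relation }.

Definition coarse_generators (X : Type) (E G : set (set (X * X))) : Prop :=
  smallest (@coarse_structure X) G = E.

Definition uniformly_locally_finite (X : Type) (E : set (set (X * X))) : Prop :=
  forall e, E e -> exists n : nat, forall x, [set y | e (x, y)] #<= `I_n.

Definition coarsely_close (X : Type) (E : set (set (X * X))) (Z : Type) (f g : Z -> X) :
  Prop := E (range (fun z => (f z, g z))).

Definition coarse_map (X Y : Type) (E : set (set (X * X)))
    (F : set (set (Y * Y))) (f : X -> Y) : Prop :=
  forall e, E e -> exists2 e', F e' &
    forall x x', e (x, x') -> e' (f x, f x').

Definition coarse_equivalence (X Y : Type) (E : set (set (X * X)))
    (F : set (set (Y * Y))) (f : X -> Y) : Prop :=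
  coarse_map E F f /\
  exists g : Y -> X, [/\ coarse_map F E g, coarsely_close E (g \o f) id &
                         coarsely_close F (f \o g) id].

Definition coarsely_equivalent (X Y : Type) (E : set (set (X * X)))
    (F : set (set (Y * Y))) : Prop :=
  exists f : X -> Y, coarse_equivalence E F f.

(* [A] realizes the minimal cardinality of the members of [P]. *)
Definition min_card (T : Type) (P : set (set T)) (A : set T) : Prop :=
  P A /\ forall B, P B -> A #<= B.

Lemma min_card_exists (T : Type) (P : set (set T)) :
  P !=set0 -> exists A, min_card P A.
Proof.
move=> [A0 PA0]; have [P0|P0] := pselect (P set0).
  by exists set0; split=> // B _; exact: subset_card_le.
have {}P0 A : P A -> exists t, A t.
  by move=> PA; apply/set0P/eqP => A_eq0; apply: P0; rewrite -A_eq0.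
have [t0 _] := P0 _ PA0.
pose Q (S : set (set T -> T)) := (forall f, S f -> forall A, P A -> A (f A)) /\
  forall A, P A -> forall f g, S f -> S g -> f A = g A -> f = g.
have [F FQ totF|S [[SP Sinj] Smax]] := @Zorn_bigcup _ Q.
  split=> [f [S FS Sf] A PA|A PA f g [S FS Sf] [S' FS' S'g]].
    exact: (FQ _ FS).1 f Sf A PA.
  have [SS'|S'S] := totF _ _ FS FS'.
    by apply: (FQ _ FS').2 => //; exact: SS'.
  by apply: (FQ _ FS).2 => //; exact: S'S.
have [A [PA AS]] : exists A, P A /\ A `<=` [set f A | f in S].
  apply: contrapT => noA.
  have /choice[f fP] : forall A, exists t, P A -> A t /\ ~ [set g A | g in S] t.
    move=> A; have [PA|] := pselect (P A); last by exists t0.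
    apply: contrapT => noP; apply: noA; exists A; split=> // t At.
    by apply: contrapT => nSt; apply: noP; exists t.
  apply: (Smax (f |` S)); last split.
  - split=> [g Sg|fS]; first by right.
    by have [_] := fP _ PA0; apply; exists f => //; apply: fS; left.
  - move=> g [->|/SP//] A PA; exact: (fP _ PA).1.
  - move=> A PA g h [->|Sg] [->|Sh] // e; last exact: (Sinj A).
    + by have [_] := fP _ PA; case; exists h.
    + by have [_] := fP _ PA; case; exists g.
have /choice[h hP] : forall t, exists f, A t -> S f /\ f A = t.
  move=> t; have [/AS[f Sf <-]|] := pselect (A t); first by exists f.
  by exists (fun=> t0).
exists A; split=> // B PB.
have /card_eqPle[_ hA] : [set h t B | t in A] #= A.
  apply: inj_card_eq => s t; rewrite !inE => /hP[Shs hs] /hP[Sht ht] hst.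
  by rewrite -hs -ht (Sinj B PB _ _ Shs Sht hst).
apply: card_le_trans hA _; apply: subset_card_le => _ [t /hP[Sht _] <-].
exact: SP PB.
Qed.

Definition unit_disk (R : realType) : set (R[i]^o) := [set z | `|z| <= 1].

(* D^X with the product topology, D carrying the topology induced from C. *)
Definition disk_power (R : realType) (X : Type) : topologicalType :=
  {ptws X -> @unit_disk R}.

Definition nowhere_dense (T : topologicalType) (A : set T) : Prop :=
  (closure A)^° = set0.

Definition nowhere_dense_cover (T : topologicalType) (N : set (set T)) : Prop :=
  (forall A, N A -> nowhere_dense A) /\ \bigcup_(A in N) A = setT.

(* Minimal generating sets always exist, and so do minimal covers once
   some cover exists (min_card_exists), which is the case unless [X] is empty.
   For empty [X], D^X is a point, which has no cover by nowhere dense sets;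
   cov(D^X) is then the infimum of an empty class, larger than any cardinal,
   and every such space is small. *)
Definition small_coarse (R : realType) (X : Type) (E : set (set (X * X))) :
    Prop :=
  forall (N : set (set (disk_power R X))) (G : set (set (X * X))),
    min_card (@nowhere_dense_cover (disk_power R X)) N ->
    min_card (coarse_generators E) G ->
    G #<= N /\ ~ (N #<= G).

Definition square_summable (R : realType) (X : choiceType) :
    {pred X -> R[i]^o} :=
  fun u => `[< (\esum_(x in [set: X]) (normc (u x) ^+ 2)%:E < +oo)%E >].

Section ell2.
Variables (R : realType) (X : choiceType).

Let normc_ge0 (z : R[i]) : 0 <= normc z.
Proof. by case: z => a b; exact: sqrtr_ge0. Qed.

Lemma square_summable_submod : submod_closed (@square_summable R X).
Proof.
split=> [|a u v /asboolP su /asboolP sv]; apply/asboolP.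
  by rewrite esum1 ?ltry// => x _; rewrite normc0 expr0n.
have le2 (x : X) : normc ((a *: u + v) x) ^+ 2 <=
    (2 * normc a ^+ 2) * normc (u x) ^+ 2 + 2 * normc (v x) ^+ 2.
  have -> : (a *: u + v) x = a * u x + v x by [].
  apply: (@le_trans _ _ ((normc a * normc (u x) + normc (v x)) ^+ 2)).
    rewrite ler_pXn2r ?nnegrE ?addr_ge0 ?mulr_ge0//.
    by rewrite -normcM; exact: le_normcD.
  rewrite -subr_ge0.
  set p := normc a; set q := normc (u x); set r := normc (v x).
  have -> : 2 * p ^+ 2 * q ^+ 2 + 2 * r ^+ 2 - (p * q + r) ^+ 2 =
    (p * q - r) ^+ 2 by ring.
  exact: sqr_ge0.
have esumZ (c : R) (f : X -> R) : 0 <= c -> (forall x, 0 <= f x) ->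
    (\esum_(x in [set: X]) (f x)%:E < +oo)%E ->
    (\esum_(x in [set: X]) (c * f x)%:E < +oo)%E.
  move=> c0 f0 sf.
  apply: (@le_lt_trans _ _ (c%:E * \esum_(x in [set: X]) (f x)%:E)%E); last first.
    by rewrite lte_mul_pinfty ?lee_fin.
  apply: ge_ereal_sup => _ [A [finA _] <-].
  under eq_fsbigr do rewrite EFinM.
  rewrite -ge0_mule_fsumr//.
  rewrite lee_wpmul2l ?lee_fin//; apply: ereal_sup_ubound.
  by exists A.
apply: le_lt_trans (_ : (_ <= \esum_(x in [set: X])
   (((2 * normc a ^+ 2) * normc (u x) ^+ 2)%:E +
    (2 * normc (v x) ^+ 2)%:E))%E) _.
  by apply: le_esum => x _; rewrite -EFinD lee_fin.
have n2 (z : R[i]) : 0 <= normc z ^+ 2 by rewrite exprn_ge0.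
rewrite esumD; last 2 first.
- by move=> x _; rewrite lee_fin !mulr_ge0.
- by move=> x _; rewrite lee_fin mulr_ge0.
by apply: lte_add_pinfty; apply: esumZ => //; rewrite mulr_ge0.
Qed.

HB.instance Definition _ :=
  GRing.isSubmodClosed.Build R[i] (X -> R[i]^o) (@square_summable R X)
    square_summable_submod.

Record ell2 := Ell2 {
  ell2_fun :> X -> R[i]^o;
  _ : ell2_fun \in @square_summable R X }.

HB.instance Definition _ := [isSub for ell2_fun].
HB.instance Definition _ := [Choice of ell2 by <:].
HB.instance Definition _ := [SubChoice_isSubLmodule of ell2 by <:].

Lemma delta_subproof (x : X) :
  (fun y => (y == x)%:R : R[i]^o) \in @square_summable R X.
Proof.
apply/asboolP; rewrite (esumID [set x])//; last first.
  by move=> y _; rewrite lee_fin exprn_ge0.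
rewrite setTI esum_set1 ?lee_fin ?exprn_ge0// esum1 ?adde0 ?ltry//.
by move=> y [_ /eqP/negPf ->]; rewrite normc0 expr0n.
Qed.

Definition delta (x : X) : ell2 := Ell2 (delta_subproof x).

(* Unordered sum over X, i.e. the limit along the finite subsets of X. *)
Definition dot (u v : ell2) : R[i] :=
  summability.sum (fun x => u x * (v x)^* : R[i]^o).

Definition ell2_norm (u : ell2) : R :=
  Num.sqrt (fine (\esum_(x in [set: X]) (normc (u x) ^+ 2)%:E)%E).

End ell2.

Definition bounded_operator (R : realType) (X Y : choiceType)
    (T : ell2 R X -> ell2 R Y) : Prop :=
  linear T /\ exists M : R, forall u, ell2_norm (T u) <= M * ell2_norm u.

Definition opnorm (R : realType) (X Y : choiceType)
    (T : ell2 R X -> ell2 R Y) : R :=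
  sup [set ell2_norm (T u) | u in [set u | ell2_norm u <= 1]].

Definition is_adjoint (R : realType) (X Y : choiceType)
    (T : ell2 R X -> ell2 R Y) (T' : ell2 R Y -> ell2 R X) : Prop :=
  bounded_operator T' /\ forall u v, dot (T u) v = dot u (T' v).

(* [U'] is the adjoint of the unitary [U]. *)
Definition unitary_with_adjoint (R : realType) (X Y : choiceType)
    (U : ell2 R X -> ell2 R Y) (U' : ell2 R Y -> ell2 R X) : Prop :=
  [/\ bounded_operator U, is_adjoint U U', U' \o U = id & U \o U' = id].

Definition supp (R : realType) (X : choiceType) (T : ell2 R X -> ell2 R X) :
    set (X * X) :=
  [set p | dot (T (delta R p.1)) (delta R p.2) != 0].

Definition algebraic_uniform_Roe (R : realType) (X : choiceType)
    (E : set (set (X * X))) : set (ell2 R X -> ell2 R X) :=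
  [set T | bounded_operator T /\ E (supp T)].

Definition uniform_Roe (R : realType) (X : choiceType)
    (E : set (set (X * X))) : set (ell2 R X -> ell2 R X) :=
  [set T | bounded_operator T /\ forall eps : R, 0 < eps ->
    exists2 S, algebraic_uniform_Roe E S & opnorm (T - S) < eps].

Definition star_isomorphism (R : realType) (X Y : choiceType)
    (A : set (ell2 R X -> ell2 R X)) (B : set (ell2 R Y -> ell2 R Y))
    (phi : (ell2 R X -> ell2 R X) -> (ell2 R Y -> ell2 R Y)) : Prop :=
  [/\ set_bij A B phi,
      forall (a : R[i]) S T, A S -> A T -> phi (a *: S + T) = a *: phi S + phi T,
      forall S T, A S -> A T -> phi (S \o T) = phi S \o phi T &
      forall S S', A S -> A S' -> is_adjoint S S' ->
        is_adjoint (phi S) (phi S')].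

(* The infimum and the suprema are taken in the extended reals, so that
   the infimum over an empty index set is +oo. *)
Definition rigidly_isomorphic (R : realType) (X Y : choiceType)
    (E : set (set (X * X))) (F : set (set (Y * Y))) : Prop :=
  exists (U : ell2 R X -> ell2 R Y) (U' : ell2 R Y -> ell2 R X),
  [/\ unitary_with_adjoint U U',
      star_isomorphism (uniform_Roe E) (uniform_Roe F)
        (fun T => U \o T \o U'),
      (0 < ereal_inf (range (fun x => ereal_sup (range (fun y =>
         (normc (dot (U (delta R x)) (delta R y)))%:E)))))%E &
      (0 < ereal_inf (range (fun y => ereal_sup (range (fun x =>
         (normc (dot (U' (delta R y)) (delta R x)))%:E)))))%E].

(* Main.v *)
(* Let Phi(T) = U T U*, and choose f : X -> Y and g : Y -> X with |<U d_x, d_(f x)>| and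
   |<U* d_y, d_(g y)>| bounded below.  For (x, x') in X * X, the operator Phi(e_(x,x')) has
   (y, y')-coefficient <U* d_y, d_x> <U d_x', d_y'>.  The claim is that for an entourage e of X
   the pairs (y, y') where this coefficient is at least eps, for some (x, x') in e, form an
   entourage of Y.  Taking y = f x and y' = f x' shows that f is coarse, exchanging U and U*
   shows that g is, and applying the claim to the two diagonals shows that g o f and f o g
   are close to the identities.

   For the claim, e may be taken to be a partial bijection on whose domain f is injective,
   since f has uniformly bounded fibres.  For t in D^Y let W_t send d_x to t(f x) d_x' for
   (x, x') in e; this is in the Roe algebra of X.  For an entourage A of Y, the set C_A of
   those t for which the coefficients of Phi(W_t) outside A are at most eps / 3 is closed,
   and the C_A cover D^Y as A runs through finite words in a minimal generating set.  There
   are countably many such words, or as many as generators, so by smallness (or Baire's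
   theorem) some C_A has an interior point.  Hence, for f x outside a finite set, the
   coordinate f x can be switched between 0 and 1 within C_A, and this changes Phi(W_t) by
   exactly Phi(e_(x,x')); each of the finitely many other coordinates is treated by itself. *)
Require Import Defs.
From mathcomp Require Import all_boot all_order all_algebra.
From mathcomp Require Import finmap ring lra complex.
From mathcomp Require Import all_classical all_reals all_analysis.
From mathcomp.analysis.showcase Require summability.

Set Implicit Arguments.
Unset Strict Implicit.
Unset Printing Implicit Defensive.

Import Order.TTheory GRing.Theory Num.Theory.
Import numFieldNormedType.Exports.
Import Normc.

Local Open Scope classical_set_scope.
Local Open Scope card_scope.
Local Open Scope ring_scope.
Local Open Scope complex_scope.

(** * Baire's theorem for powers of the disk *)

(** This is the inductive step of Baire's theorem: [O] minus the closure of [A] is open and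
    nonempty, and regularity fits a closed neighbourhood inside it. *)
Lemma nowhere_dense_avoid (T : topologicalType) (A O : set T) :
  regular_space T -> nowhere_dense A -> open O -> O !=set0 ->
  exists V, [/\ open V, V !=set0, closure V `<=` O & closure V `<=` ~` A].
Proof.
move=> regT ndA oO [t Ot].
have [p [Op nAp]] : exists p, O p /\ ~ closure A p.
  apply: contrapT => noP; suff : (closure A)^° t by rewrite ndA.
  apply: (@filterS _ _ _ O); last exact: open_nbhs_nbhs.
  by move=> q Oq; apply: contrapT => nAq; apply: noP; exists q.
have : nbhs p (O `&` ~` closure A).
  apply: filterI; first exact: open_nbhs_nbhs.
  by apply: open_nbhs_nbhs; split=> //; apply: closed_openC; exact: closed_closure.
move=> /regT[B pB cBO]; exists B^°; split.
- exact: open_interior.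
- by exists p.
- by move=> q /(closureS (@interior_subset _ B))/cBO[].
- move=> q /(closureS (@interior_subset _ B))/cBO[_ nAq] Aq; apply: nAq.
  exact: subset_closure.
Qed.

Lemma compact_regular_Baire (T : topologicalType) (A : nat -> set T) :
  compact [set: T] -> regular_space T -> [set: T] !=set0 ->
  (forall n, nowhere_dense (A n)) -> exists t, forall n, ~ A n t.
Proof.
move=> cT regT T0 ndA.
have /choice[f fP] : forall nO : nat * set T, exists V, open nO.2 -> nO.2 !=set0 ->
    [/\ open V, V !=set0, closure V `<=` nO.2 & closure V `<=` ~` A nO.1].
  move=> [n O]; have [[oO O0]|nO] := pselect (open O /\ O !=set0).
    have [V VP] := nowhere_dense_avoid regT (ndA n) oO O0.
    by exists V.
  by exists setT => oO O0; case: nO.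
pose O := fix O n := if n is m.+1 then f (m, O m) else [set: T].
have oO n : open (O n) /\ O n !=set0.
  elim: n => [|n [on n0]]; first by split=> //; exact: openT.
  by have [] := fP (n, O n) on n0.
have OS n : closure (O n.+1) `<=` O n /\ closure (O n.+1) `<=` ~` A n.
  by have [on n0] := oO n; have [] := fP (n, O n) on n0.
have Omono m n : (m <= n)%N -> O n `<=` O m.
  elim: n => [|n IHn]; first by rewrite leqn0 => /eqP ->.
  rewrite leq_eqVlt => /predU1P[-> //|]; rewrite ltnS => /IHn; apply: subset_trans.
  by move=> t /subset_closure; exact: (OS n).1.
(* A cluster point of the filter generated by the nested [O n] lies in the closure of every
   [O n.+1], hence outside every [A n]. *)
have FP : ProperFilter (filter_from [set: nat] O).
  apply: filter_from_proper; last by move=> n _; case: (oO n).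
  apply: filter_from_filter; first by exists 0%N.
  move=> i j _ _; exists (maxn i j) => // t Ot.
  by split; apply: Omono Ot; rewrite ?leq_maxl ?leq_maxr.
have [t [_ tO]] := cT _ FP (filterT : filter_from [set: nat] O [set: T]).
exists t => n; apply: (OS n).2 => B tB.
by apply: tO => //; exists n.+1.
Qed.

Lemma normc_ge0 (R : rcfType) (z : R[i]) : 0 <= normc z.
Proof. by case: z => a b; exact: sqrtr_ge0. Qed.

Lemma normc_le_ReIm (R : rcfType) (z : R[i]) :
  normc z <= `|complex.Re z| + `|complex.Im z|.
Proof.
case: z => a b /=; have s0 : 0 <= `|a| + `|b| by rewrite addr_ge0.
rewrite -(ger0_norm s0) -[leRHS]sqrtr_sqr ler_sqrt ?sqr_ge0// sqrrD !real_normK ?num_real//.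
by rewrite -addrA lerD2l lerDr mulrn_wge0// mulr_ge0.
Qed.

Lemma complex_gt0 (R : rcfType) (e : R[i]) : 0 < e ->
  0 < complex.Re e /\ e = (complex.Re e)%:C.
Proof. by case: e => a b; rewrite ltcE /= => /andP[/eqP-> ->]. Qed.

(** The disk is a closed subset of the continuous image of a square. *)
Lemma unit_disk_compact (R : realType) : compact (@unit_disk R).
Proof.
pose q (x : R * R) : R[i]^o := x.1 +i* x.2.
have q_cont : continuous q.
  move=> x; apply/cvgrPdist_lt => /= e /complex_gt0[e0 ->].
  have {}e0 : 0 < complex.Re e / 2 by rewrite divr_gt0.
  near=> y; rewrite ltcR; apply: le_lt_trans (normc_le_ReIm _) _ => /=.
  rewrite [ltRHS]splitr; apply: ltrD; near: y.
    by move: (complex.Re e / 2) e0; apply/cvgrPdist_lt; exact: cvg_fst.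
  by move: (complex.Re e / 2) e0; apply/cvgrPdist_lt; exact: cvg_snd.
have cK : compact (q @` (`[-1, 1] `*` `[-1, 1])).
  apply: continuous_compact; first exact: continuous_subspaceT.
  by apply: compact_setX; exact: segment_compact.
apply: subclosed_compact cK _.
  move=> z cz; rewrite /unit_disk /=; apply: contrapT => /negP.
  rewrite -real_ltNge ?normr_real ?real1// -subr_gt0 => z1.
  have [w [/= w1]] := cz _ (nbhsx_ballx z _ z1).
  rewrite -ball_normE /ball_ /= => zw.
  have := ltr_leD zw w1; rewrite subrK => /(le_lt_trans (ler_normD _ _)).
  by rewrite subrK ltxx.
case=> a b; rewrite /unit_disk /= lecR => ab1; exists (a, b) => //.
have ab : a ^+ 2 + b ^+ 2 <= 1.
  by rewrite -(ler_sqrt _ ler01) sqrtr1.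
split=> /=; rewrite in_itv /= -ler_norml -sqrtr_sqr -sqrtr1 ler_sqrt//;
  apply: le_trans ab; rewrite ?lerDl ?lerDr ?sqr_ge0//.
Unshelve. all: by end_near.
Qed.

Lemma compact_set_type (T : topologicalType) (A : set T) :
  compact A -> compact [set: A].
Proof.
move=> cA F FF _.
have FA : (set_val @ F) A.
  by rewrite nbhs_simpl /=; apply: filterS filterT => x _; exact: set_valP.
have [p [Ap pF]] := cA _ _ FA.
exists (exist _ p (mem_set Ap)); split=> // B V FB [_ [[W oW <-] /= Wp] WV].
have [_ [[b Bb <-] Wb]] : (set_val @` B) `&` W !=set0.
  apply: pF; last exact: open_nbhs_nbhs.
  by rewrite nbhs_simpl /=; apply: filterS FB => x Bx; exists x.
by exists b; split=> //; exact: WV.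
Qed.

Lemma disk_power_compact (R : realType) (X : choiceType) :
  compact [set: disk_power R X].
Proof.
have := @tychonoff X (fun=> @unit_disk R : topologicalType) (fun=> setT)
  (fun=> compact_set_type (@unit_disk_compact R)).
by congr compact; apply/seteqP; split.
Qed.

(** Points outside the disk get the default 0; the arguments that matter below are 0 and 1. *)
Definition to_disk (R : realType) (z : R[i]) : @unit_disk R :=
  if pselect (@unit_disk R z) is left h then exist _ z (mem_set h)
  else exist _ 0 (mem_set (ltac:(by rewrite /unit_disk /= normr0) : @unit_disk R 0)).

Lemma to_diskK (R : realType) (z : R[i]) : `|z| <= 1 -> set_val (to_disk z) = z :> R[i].
Proof. by rewrite /to_disk; case: pselect. Qed.

(* Stated for an abstract [T]: at the disk itself this conversion takes minutes. *)
Lemma ptws_regular (X : Type) (T : uniformType) : regular_space {ptws X -> T}.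
Proof. exact: uniform_regular. Qed.

Lemma disk_power_regular (R : realType) (X : choiceType) :
  regular_space (disk_power R X).
Proof. exact: (@ptws_regular X (@unit_disk R)). Qed.

Lemma disk_power_Baire (R : realType) (X : choiceType)
    (N : set (set (disk_power R X))) :
  nowhere_dense_cover N -> ~ countable N.
Proof.
move=> [ndN covN] cN.
have nd0 : nowhere_dense (set0 : set (disk_power R X)).
  by rewrite /nowhere_dense closure0 interior0.
have [A AP] : exists A : nat -> set (disk_power R X),
    (forall n, nowhere_dense (A n)) /\ forall B, N B -> exists n, A n = B.
  have /pcard_injP[f fI] := cN.
  (* [A n] is the member of [N] with code [n], or the nowhere dense [set0] if there is none. *)
  pose A n := xget set0 [set B | N B /\ f B = n].
  exists A; split=> [n|B NB].
    by rewrite /A; case: xgetP => [B _ [/ndN//]|_].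
  exists (f B); rewrite /A; case: xgetP => [C _ [NC /fI]|/(_ B)[]//].
  by rewrite !inE; exact.
have D0 : [set: disk_power R X] !=set0 by exists (fun=> to_disk 0).
have [t tP] := compact_regular_Baire (@disk_power_compact R X)
  (@disk_power_regular R X) D0 AP.1.
have [B NB Bt] : (\bigcup_(A in N) A) t by rewrite covN.
by have [n An] := AP.2 _ NB; apply: (tP n); rewrite An.
Qed.

(** * Cardinality of finite words *)

Lemma card_le_inj (T U : Type) (A : set T) (B : set U) :
  inhabited U -> A #<= B ->
  exists f : T -> U, (forall a, A a -> B (f a)) /\ set_inj A f.
Proof.
move=> [u0] /card_leP[f].
exists (fun t => if pselect (A t) is left At then set_val (f (exist _ t (mem_set At)))
                 else u0).
split=> [a Aa|a b]; first by case: pselect => // Aa'; exact: set_valP.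
rewrite !inE => Aa Ab; case: pselect => // Aa'; case: pselect => // Ab'.
by move=> /val_inj /(inj (mem_setT _) (mem_setT _)) [].
Qed.

Section infinite_square.
Variable T : Type.
Implicit Types (M : set (T * T * T)).

Let field M : set T := [set a | exists c, M (a, a, c)].

(* [M] is the graph of an injection of B x B into B, where B = field M. *)
Let good M := [/\ forall p c d, M (p, c) -> M (p, d) -> c = d,
  forall p q c, M (p, c) -> M (q, c) -> p = q,
  forall a b c, M (a, b, c) -> [/\ field M a, field M b & field M c] &
  forall a b, field M a -> field M b -> exists c, M (a, b, c)].

Let field_sub M M' : M `<=` M' -> field M `<=` field M'.
Proof. by move=> MM' a [c Mc]; exists c; exact: MM'. Qed.

Let good_bigcup (K : set (set (T * T * T))) :
  K `<=` good -> total_on K subset -> good (\bigcup_(M in K) M).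
Proof.
move=> Kgood Ktot.
have common p q : (\bigcup_(M in K) M) p -> (\bigcup_(M in K) M) q ->
    exists M, [/\ K M, M p & M q].
  move=> [M KM Mp] [M' KM' M'q].
  have [MM'|M'M] := Ktot _ _ KM KM'.
    by exists M'; split=> //; exact: MM'.
  by exists M; split=> //; exact: M'M.
split.
- move=> p c d Kc Kd; have [M [/Kgood[fM _ _ _] Mc Md]] := common _ _ Kc Kd.
  exact: fM Mc Md.
- move=> p q c Kp Kq; have [M [/Kgood[_ iM _ _] Mp Mq]] := common _ _ Kp Kq.
  exact: iM Mp Mq.
- move=> a b c [M KM Mc]; have [_ _ rM _] := Kgood _ KM.
  by have [Ma Mb Mc'] := rM _ _ _ Mc; split; apply: field_sub (bigcup_sup KM) _ _.
- move=> a b [c Kc] [d Kd]; have [M [KM Mc Md]] := common _ _ Kc Kd.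
  have [_ _ _ tM] := Kgood _ KM.
  by have [|| e Me] := tM a b; [exists c|exists d|exists e, M].
Qed.

(** Zorn's lemma gives a maximal good [M] above a countable one. By maximality the complement of its
    field [B] is no larger than [B], so two tagged copies of [B] inside [B] absorb all of [T]. *)
Lemma infinite_square_inj :
  infinite_set [set: T] -> exists f : T * T -> T, injective f.
Proof.
move=> Tinf.
have T0 : inhabited T by have [t _] := infinite_setN0 Tinf.
have [i iI] : exists i : nat -> T, injective i.
  have /infiniteP/(card_le_inj T0)[i [_ iI]] := Tinf.
  by exists i => m n; apply: iI; rewrite inE.
(* The pairing of natural numbers maps the square of the range of [i] into that range; starting from
   it puts the distinct tags [i n] into [B]. *)
pose M0 : set (T * T * T) := [set (i mn.1, i mn.2, i (choice.pickle mn)) | mn in [set: nat * nat]].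
have field0 n : field M0 (i n) by exists (i (choice.pickle (n, n))); exists (n, n).
have good0 : good M0.
  split.
  - by move=> [a b] c d [[m n] _ [<- <- <-]] [[m' n'] _ [/iI<- /iI<- <-]].
  - move=> p q c [m _ [<- <-]] [n _ [<- /iI]].
    by move=> /(pcan_inj choice.pickleK) ->.
  - by move=> a b c [[m n] _ [<- <- <-]]; split; exact: field0.
  - move=> a b [c [[m n] _ [<- _ _]]] [d [[m' n'] _ [<- _ _]]].
    by exists (i (choice.pickle (m, m'))); exists (m, m').
have [M [M0M goodM maxM]] : exists M, [/\ M0 `<=` M, good M &
    forall M', good M' -> M `<=` M' -> M' `<=` M].
  (* Zorn's lemma is applied to the sets whose union with [M0] is good: this keeps [M0] below the
     maximal set, and the empty chain yields [M0] itself. *)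
  have [F FP Ftot|M [goodM maxM]] := @Zorn_bigcup _ (fun M => good (M0 `|` M)).
    pose K := M0 |` [set M0 `|` M | M in F].
    have -> : M0 `|` \bigcup_(M in F) M = \bigcup_(M in K) M.
      apply/seteqP; split=> [p [M0p|[M FM Mp]]|p [_ [->|[M FM <-]]]].
      + by exists M0 => //; left.
      + by exists (M0 `|` M); [right; exists M|right].
      + by left.
      + by move=> [|Mp]; [left|right; exists M].
    apply: good_bigcup => [_ [->//|[M /FP ? <-//]]|].
    move=> _ _ [->|[M FM <-]] [->|[M' FM' <-]]; [by left| | | ].
    + by left; exact: subsetUl.
    + by right; exact: subsetUl.
    + by have [MM'|M'M] := Ftot _ _ FM FM'; [left|right]; exact: setUS.
  exists (M0 `|` M); split=> // M' goodM' MM'.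
  apply: contrapT => M'M; apply: (maxM M').
    split; first by move=> p Mp; apply: MM'; right.
    by move=> M'M'; apply: M'M => p /M'M'; right.
  suff -> : M0 `|` M' = M' by [].
  by apply/setUidPr => p M0p; apply: MM'; left.
have [fM iM rM tM] := goodM.
pose B := field M.
have Bi n : B (i n) by exact: field_sub M0M _ (field0 n).
have [f fP] : exists f : T * T -> T, forall a b, B a -> B b -> M (a, b, f (a, b)).
  have /choice[f fP] : forall p : T * T, exists c, B p.1 -> B p.2 -> M (p, c).
    move=> [a b]; have [[Ba Bb]|nB] := pselect (B a /\ B b).
      by have [c Mc] := tM _ _ Ba Bb; exists c.
    by case: T0 => t0; exists t0 => Ba Bb; case: nB.
  by exists f => a b; exact: (fP (a, b)).
have fB a b : B a -> B b -> B (f (a, b)).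
  by move=> Ba Bb; have [] := rM _ _ _ (fP _ _ Ba Bb).
have fI a b c d : B a -> B b -> B c -> B d -> f (a, b) = f (c, d) -> a = c /\ b = d.
  move=> Ba Bb Bc Bd e; have := fP _ _ Ba Bb; rewrite e => /iM/(_ (fP _ _ Bc Bd)).
  by case.
(* The two sets are comparable because one of them has minimal cardinality among the pair. *)
have [B_le|/(card_le_inj T0)[g [gB gI]]] : B #<= ~` B \/ ~` B #<= B.
  have [|A [[->|->] minA]] := @min_card_exists _ [set B; ~` B]; first by exists B; left.
    by left; apply: minA; right.
  by right; apply: minA; left.
(* A copy g(B) of B would fit in the complement, and M would extend to B `|` g(B). *)
- have [g [gB /= gI]] := card_le_inj T0 B_le; exfalso.
  pose L (e : bool) a := if e then g a else a.
  have LI e a e' a' : B a -> B a' -> L e a = L e' a' -> e = e' /\ a = a'.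
    case: e e' => -[] Ba Ba' //= => [/gI|gaa'|agb']; rewrite ?inE.
    + by move=> ->.
    + by have := gB _ Ba; rewrite gaa'.
    + by have := gB _ Ba'; rewrite -agb'.
  (* [N] fills the three quadrants other than B x B of the square of B and g(B), with values in
     g(B); the tags [i 1], [i 2] and [i 3] keep the quadrants apart. *)
  pose N : set (T * T * T) := [set p | exists e e' a b, [/\ e || e', B a, B b &
    p = (L e a, L e' b, g (f (f (a, b), i (e.*2 + e')%N)))]].
  have fieldN e a : B a -> field (M `|` N) (L e a).
    case: e => Ba; last by exists (f (a, a)); left; exact: fP.
    by eexists; right; exists true, true, a, a; split.
  have NnB a b c : N (a, b, c) -> ~ (B a /\ B b).
    move=> [e [e' [a' [b' [ee' Ba' Bb' [-> -> _]]]]]] [BL BL'].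
    by case/orP: ee' BL BL' => -> /=; [move=> /(gB _ Ba')|move=> _ /(gB _ Bb')].
  have MB a b c : M (a, b, c) -> [/\ B a, B b & B c] by exact: rM.
  have NC p c : N (p, c) -> ~ B c.
    move=> [e [e' [a' [b' [ee' Ba' Bb' [_ ->]]]]]]; apply: (gB).
    by apply: (fB) => //; exact: fB.
  have fieldMN s : field (M `|` N) s -> exists e a, B a /\ s = L e a.
    move=> [c [/MB[Bs _ _]|[e [e' [a [b [_ Ba _ [-> _ _]]]]]]]]; first by exists false, s.
    by exists e, a.
  have : good (M `|` N).
    split.
    + move=> [a b] c d [Mc|Nc] [Md|Nd].
      * exact: fM Mc Md.
      * by have [Ba Bb _] := MB _ _ _ Mc; case: (NnB _ _ _ Nd).
      * by have [Ba Bb _] := MB _ _ _ Md; case: (NnB _ _ _ Nc).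
      * move: Nc Nd => [e [e' [s [t [_ Bs Bt [-> -> ->]]]]]].
        move=> [u [u' [s' [t' [_ Bs' Bt' [/(LI _ _ _ _ Bs Bs')[-> ->]]]]]]].
        by move=> /(LI _ _ _ _ Bt Bt')[-> ->] ->.
    + move=> p q c [Mp|Np] [Mq|Nq].
      * exact: iM Mp Mq.
      * by move: p Mp => [a b] /MB[_ _ Bc]; case: (NC _ _ Nq).
      * by move: q Mq => [a b] /MB[_ _ Bc]; case: (NC _ _ Np).
      * move: Np Nq => [e [e' [s [t [_ Bs Bt [-> ->]]]]]].
        move=> [u [u' [s' [t' [_ Bs' Bt' [->]]]]]] /gI; rewrite !inE.
        move=> /(_ (fB _ _ (fB _ _ Bs Bt) (Bi _)) (fB _ _ (fB _ _ Bs' Bt') (Bi _))).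
        move=> /fI[||||/fI[//|//|//|//|-> ->] /iI]; try exact: fB; try exact: Bi.
        by case: e e' u u' => -[] [] [].
    + move=> a b c [/MB[Ba Bb Bc]|].
        by split; [exact: (fieldN false)|exact: (fieldN false)|exact: (fieldN false)].
      move=> [e [e' [s [t [_ Bs Bt [-> -> ->]]]]]]; split; try exact: fieldN.
      by apply: (fieldN true); apply: (fB) => //; exact: fB.
    + move=> s t /fieldMN[e [a [Ba ->]]] /fieldMN[e' [b [Bb ->]]].
      have [ee'|] := boolP (e || e').
        by eexists; right; exists e, e', a, b; split.
      by case: e e' => -[]// _; exists (f (a, b)); left; exact: fP.
  move=> /maxM/(_ (@subsetUl _ _ _)) NM.
  have [c Nc] := fieldN true _ (Bi 0%N).
  by have [/(gB _ (Bi 0%N))] := MB _ _ _ (NM _ Nc).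
(* [h] embeds [T] into [B], the tags [i 0] and [i 1] separating [B] from its complement. *)
- pose h t := if pselect (B t) then f (t, i 0%N) else f (g t, i 1%N).
  have hB t : B (h t) by rewrite /h; case: pselect => Bt; apply: (fB) => //; exact: gB.
  have hI : injective h.
    move=> s t; rewrite /h; case: pselect => Bs; case: pselect => Bt.
    + by move=> /fI[].
    + by move=> /fI[//|//|||_ /iI//]; [exact: gB|].
    + by move=> /fI[|//|//|//|_ /iI//]; exact: gB.
    + move=> /fI[||||+ _]; [exact: gB|by []|exact: gB|by []|].
      by apply: gI; rewrite inE.
  exists (fun p => f (h p.1, h p.2)) => -[a b] [c d] /=.
  by move=> /fI[//|//|//|//|/hI -> /hI ->].
Qed.

(** A word is coded by its length and its iterated pairing. The length matters because the end
    marker [t0] may itself be the code of a pair. *)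
Lemma infinite_seq_inj :
  infinite_set [set: T] -> exists f : seq T -> T, injective f.
Proof.
move=> Tinf; have [p pI] := infinite_square_inj Tinf.
have T0 : inhabited T by have [t _] := infinite_setN0 Tinf.
have /infiniteP/(card_le_inj T0)[i [_ iI]] := Tinf.
case: T0 => t0; pose c := foldr (fun x y => p (x, y)) t0.
exists (fun s => p (i (size s), c s)) => s t /pI[] /iI.
rewrite !inE => /(_ I I).
elim: s t => [|x s IHs] [|y t]//= [st] /pI[-> cst].
by rewrite (IHs t).
Qed.

End infinite_square.

Lemma injective_card_le (T U : Type) (f : T -> U) :
  injective f -> [set: T] #<= [set: U].
Proof.
move=> fI; have [g] : $|{injfun [set: T] >-> [set: U]}|.
  by apply/injfunPex; exists f => // x y _ _; exact: fI.
exact: inj_card_le g.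
Qed.

(** * Cofinal families of entourages *)

Section generated.
Variables (X : Type) (G : set (set (X * X))).
Local Open Scope relation_scope.

Let step (l : seq (set_type G)) : set (X * X) :=
  foldr (fun g S => set_val g `|` (set_val g)^-1 `|` S) diagonal l.

Let power (l : seq (set_type G)) n : set (X * X) :=
  iter n (fun S => S \; step l) diagonal.

Let diag_step l x : step l (x, x).
Proof. by elim: l => [|g l IHl] /=; [|right]. Qed.

Let step_catl l l' : step l `<=` step (l ++ l').
Proof.
elim: l => [|g l IHl] [x y] //=; first by rewrite /diagonal /= => ->; exact: diag_step.
by case; [left|right; exact: IHl].
Qed.

Let step_catr l l' : step l' `<=` step (l ++ l').
Proof. by elim: l => [|g l IHl] p //= lp; right; exact: IHl. Qed.

Let step_inv l x y : step l (x, y) -> step l (y, x).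
Proof.
elim: l => [|g l IHl] //=.
by move=> [[gxy|gyx]|/IHl]; [left; right|left; left|right].
Qed.

Let power_sub l l' n : step l `<=` step l' -> power l n `<=` power l' n.
Proof.
move=> ll'; elim: n => //= n IHn [x y] [z /= /ll' xz /IHn zy].
by exists z.
Qed.

Let powerD l m n x y z :
  power l m (x, y) -> power l n (y, z) -> power l (m + n)%N (x, z).
Proof.
elim: m x => [|m IHm] x /=; first by rewrite /diagonal /= => ->; rewrite add0n.
by move=> [w /= xw wy] yz; exists w => //=; exact: IHm.
Qed.

Let power_inv l n x y : power l n (x, y) -> power l n (y, x).
Proof.
elim: n x => [|n IHn] x /=; first by rewrite /diagonal /= => ->.
move=> [z /= xz /IHn yz].
have zx : power l 1 (z, x) by exists x => //=; exact: step_inv.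
by have := powerD yz zx; rewrite addn1.
Qed.

Let diag_power l n x : power l n (x, x).
Proof. by elim: n => //= n IHn; exists x => //=; exact: diag_step. Qed.

(** The subsets of the relations [power l (size l)] form a coarse structure containing [G], so every
    entourage is among them. *)
Lemma coarse_generators_cofinal (E : set (set (X * X))) :
  coarse_structure E -> coarse_generators E G ->
  exists s : seq (set_type G) -> set (X * X),
    (forall l, E (s l)) /\ forall A, E A -> exists l, A `<=` s l.
Proof.
move=> Ecs EG; have GE : G `<=` E by rewrite -EG; exact: sub_gen_smallest.
(* As [step l] contains the diagonal, the length of [l] can serve as the exponent, and
   then composition is dominated by concatenation. *)
exists (fun l => power l (size l)); split.
  move=> l; have El : E (step l).
    elim: l => [|g l IHl] /=; first exact: coarse_diagonal Ecs.
    apply: (coarse_setU Ecs) => //; have Eg : E (set_val g) by exact: GE (set_valP g).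
    by apply: (coarse_setU Ecs) => //; exact: (coarse_inv Ecs).
  elim: (size l) => [|n IHn] /=; first exact: coarse_diagonal Ecs.
  exact: (coarse_comp Ecs).
rewrite -EG; apply: (@smallest_sub _ _ _ [set A | exists l, A `<=` power l (size l)]).
split.
- by exists [::].
- by move=> A B [l Bl] AB; exists l; exact: subset_trans Bl.
- by move=> A [l Al]; exists l => -[x y] /Al/power_inv.
- move=> A B [l Al] [l' Bl']; exists (l ++ l'); rewrite size_cat => -[x y] [].
    move=> /Al/(power_sub (@step_catl l l')) xy.
    exact: powerD xy (diag_power _ _ _).
  move=> /Bl'/(power_sub (@step_catr l l')) xy.
  exact: powerD (diag_power _ _ _) xy.
(* In [A \; B] the first step is taken in [B], so the two exponents add up in the order opposite to
   the concatenation. *)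
- move=> A B [l Al] [l' Bl']; exists (l ++ l'); rewrite size_cat => -[x y].
  move=> [z /= /Bl'/(power_sub (@step_catr l l')) xz].
  by move=> /Al/(power_sub (@step_catl l l')); rewrite addnC; exact: powerD xz.
- move=> A GA; exists [:: exist _ A (mem_set GA)] => -[x y] Axy.
  by exists y => //=; left; left.
Qed.

End generated.

(** Otherwise the closed sets [C (s l)], for words [l] over a minimal generating set, would form a
    nowhere dense cover that is countable or no larger than that generating set. *)
Lemma small_coarse_interior (R : realType) (X : choiceType) (E : set (set (X * X)))
    (C : set (X * X) -> set (disk_power R X)) :
  coarse_structure E -> small_coarse R E ->
  (forall A, closed (C A)) -> (forall A B, A `<=` B -> C A `<=` C B) ->
  (forall t, exists2 A, E A & C A t) ->
  exists2 A, E A & (C A)^° !=set0.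
Proof.
move=> Ecs Esmall Ccl Cmono Ccov; apply: contrapT => Cint.
have [G Gmin] : exists G, min_card (coarse_generators E) G.
  by apply: min_card_exists; exists E; exact: smallest_id.
have [s [Es scof]] := coarse_generators_cofinal Ecs Gmin.1.
pose N := range (C \o s).
have covN : nowhere_dense_cover N.
  split=> [_ [l _ <-]|].
    rewrite /nowhere_dense -(closure_id _).1//=.
    by apply/seteqP; split=> // t Ct; apply: Cint; exists (s l) => //; exists t.
  apply/seteqP; split=> // t _; have [A EA CAt] := Ccov t.
  by have [l Al] := scof _ EA; exists (C (s l)); [exists l|exact: Cmono CAt].
have [N0 N0min] := min_card_exists (ex_intro _ N covN).
have N0N : N0 #<= N := N0min.2 _ covN.
have N0s : N0 #<= [set: seq (set_type G)] := card_le_trans N0N (card_image_le _ _).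
(* Over a finite [G] the words are countable but may outnumber the generators, so Baire's theorem
   replaces the comparison with [G]. *)
have [Gfin|Ginf] := pselect (finite_set G).
  apply: (disk_power_Baire N0min.1); apply: card_le_trans N0s _.
  have /(card_le_inj (inhabits 0%N))[i [_ iI]] : countable [set: set_type G].
    by rewrite /countable (card_le_eql (card_setT _)); exact: finite_set_countable.
  have mapI : injective (map i) by apply: inj_map => x y; apply: iI; rewrite inE.
  exact: card_le_trans (injective_card_le mapI) (countableP _).
apply: (Esmall N0 G N0min Gmin).2; apply: card_le_trans N0s _.
have [|f fI] := @infinite_seq_inj (set_type G).
  by rewrite (eq_finite_set (card_setT _)).
by have := injective_card_le fI; rewrite (card_le_eqr (card_setT _)).
Qed.

(** * Operators on square summable functions *)

Section ell2_facts.
Variables (R : realType) (X : choiceType).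
Implicit Types (u v : ell2 R X) (x y : X).

Lemma ell2E (a : R[i]) u v x : (a *: u + v) x = a * u x + v x.
Proof. by []. Qed.

Lemma ell2_ext u v : (forall x, u x = v x) -> u = v.
Proof. by move=> uv; apply: val_inj; apply/funext. Qed.

Lemma ell2_normE u :
  (ell2_norm u ^+ 2)%:E = (\esum_(x in [set: X]) (normc (u x) ^+ 2)%:E)%E.
Proof.
have /asboolP su := valP u.
have s0 : (0 <= \esum_(x in [set: X]) (normc (u x) ^+ 2)%:E)%E.
  by apply: esum_ge0 => x _; rewrite lee_fin exprn_ge0// normc_ge0.
rewrite /ell2_norm sqr_sqrtr; last exact: fine_ge0.
by rewrite fineK// ge0_fin_numE.
Qed.

Lemma ell2_norm_ge0 u : 0 <= ell2_norm u.
Proof. exact: sqrtr_ge0. Qed.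

Lemma ell2_norm_le u (c : R) : 0 <= c ->
  (\esum_(x in [set: X]) (normc (u x) ^+ 2)%:E <= (c ^+ 2)%:E)%E -> ell2_norm u <= c.
Proof.
move=> c0; rewrite -ell2_normE lee_fin ler_pXn2r ?nnegrE//; exact: ell2_norm_ge0.
Qed.

Lemma sum_normc_le_ell2_norm u (s : seq X) : uniq s ->
  \sum_(x <- s) normc (u x) ^+ 2 <= ell2_norm u ^+ 2.
Proof.
move=> us; rewrite -lee_fin ell2_normE; apply: esum_ge.
exists [set` s] => //.
by rewrite -fsbig_seq// sumEFin lexx.
Qed.

Lemma normc_le_ell2_norm u x : normc (u x) <= ell2_norm u.
Proof.
have := @sum_normc_le_ell2_norm u [:: x] isT.
by rewrite big_seq1 ler_pXn2r// nnegrE ?normc_ge0// ell2_norm_ge0.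
Qed.

(** [A] indexes a partial sum within [e] of the supremum of all partial sums. *)
Lemma ell2_norm_tail u (e : R) : 0 < e -> exists2 A : set X, finite_set A &
  (\esum_(x in ~` A) (normc (u x) ^+ 2)%:E <= e%:E)%E.
Proof.
move=> e0.
have su : (\esum_(x in [set: X]) (normc (u x) ^+ 2)%:E < +oo)%E.
  by have /asboolP := valP u.
have n0 x : (0 <= (normc (u x) ^+ 2)%:E)%E by rewrite lee_fin exprn_ge0// normc_ge0.
have sfin : (\esum_(x in [set: X]) (normc (u x) ^+ 2)%:E)%E \is a fin_num.
  by rewrite ge0_fin_numE ?esum_ge0//.
have [_ [A [Afin _] <-] Ae] := ub_ereal_sup_adherent e0 sfin.
exists A => //; move: Ae; rewrite -/(esum _ _) (esumID A)// !setTI -esum_fset//.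
have Aoo : (\esum_(x in A) (normc (u x) ^+ 2)%:E)%E \is a fin_num.
  rewrite ge0_fin_numE ?esum_ge0// (le_lt_trans _ su)//.
  by rewrite [leRHS](esumID A)// !setTI leeDl// esum_ge0.
by rewrite lteBlDr// => /ltW; rewrite leeD2lE.
Qed.

(** A crude triangle inequality from (a + b)^2 <= 2 a^2 + 2 b^2 at each point; it serves to bound
    the set whose supremum is [opnorm (T - S)]. *)
Lemma ell2_normB_le u v : ell2_norm (u - v) <= 2 * (ell2_norm u + ell2_norm v).
Proof.
have [un vn] := (ell2_norm_ge0 u, ell2_norm_ge0 v).
apply: ell2_norm_le; first by rewrite mulr_ge0// addr_ge0.
have n0 w x : (0 <= (normc (w x : R[i]) ^+ 2)%:E)%E by rewrite lee_fin exprn_ge0// normc_ge0.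
apply: (@le_trans _ _ (\esum_(x in [set: X]) ((normc (u x) ^+ 2)%:E +
    (normc (u x) ^+ 2)%:E + ((normc (v x) ^+ 2)%:E + (normc (v x) ^+ 2)%:E)))%E).
  apply: le_esum => x _; rewrite -!EFinD lee_fin.
  have uv : normc ((u - v) x) <= normc (u x) + normc (v x).
    by rewrite -(normcN (v x)); exact: le_normcD.
  apply: (@le_trans _ _ ((normc (u x) + normc (v x)) ^+ 2)).
    by rewrite ler_pXn2r// nnegrE ?addr_ge0// normc_ge0.
  by have := sqr_ge0 (normc (u x) - normc (v x)); lra.
rewrite !esumD//; try by move=> x _; rewrite adde_ge0.
rewrite -!ell2_normE -!EFinD lee_fin.
by have := mulr_ge0 un vn; have := sqr_ge0 (ell2_norm u); have := sqr_ge0 (ell2_norm v); lra.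
Qed.

Lemma delta_norm x : ell2_norm (delta R x) = 1.
Proof.
rewrite /ell2_norm (esumID [set x])//; last first.
  by move=> y _; rewrite lee_fin exprn_ge0// normc_ge0.
rewrite setTI esum_set1 ?lee_fin ?exprn_ge0 ?normc_ge0// esum1.
  by rewrite adde0 /= eqxx normc1 expr1n sqrtr1.
by move=> y [_ /eqP/negPf /= ->]; rewrite normc0 expr0n.
Qed.

End ell2_facts.

Section dot_delta.
Variables (R : realType) (X : choiceType).
Implicit Types (u v : ell2 R X) (x y : X).

(** A partial sum equals [h x] as soon as its finite index set contains [x]. *)
Let sum_support1 (h : X -> R[i]^o) x : (forall y, y != x -> h y = 0) ->
  summability.sum h = h x.
Proof.
move=> h0; have FF := @summability.totally_filter X.
apply: (@cvg_lim _ (@norm_hausdorff _ _) _ _ FF).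
apply: (@cvg_near_cst _ _ _ _ _ (@filter_filter _ _ FF)).
exists [fset x]%fset => // B /=; rewrite fsub1set => xB.
rewrite /summability.partial_sum (bigD1 [` xB]%fset)//= big1 ?addr0// => y yx.
by apply: h0; apply: contraNneq yx => yx; apply/eqP/val_inj.
Qed.

Lemma dot_deltar u x : dot u (delta R x) = u x.
Proof.
rewrite /dot (@sum_support1 _ x) /=.
  by rewrite eqxx -[RHS]mulr1; congr (_ * _); exact: conjc1.
by move=> y /negPf ->; rewrite -[RHS](mulr0 (u y)); congr (_ * _); exact: conjc0.
Qed.

Lemma dot_deltal v x : dot (delta R x) v = (v x)^*.
Proof.
rewrite /dot (@sum_support1 _ x) /= ?eqxx ?mulr1n ?mul1r//.
by move=> y /negPf ->; rewrite mul0r.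
Qed.

End dot_delta.

Lemma normc_conj (R : rcfType) (z : R[i]) : normc z^* = normc z.
Proof. by case: z => a b /=; rewrite sqrrN. Qed.

Section bounded.
Variables (R : realType) (X Y : choiceType).
Implicit Types T S : ell2 R X -> ell2 R Y.

Lemma bounded_ge0 T : bounded_operator T ->
  exists2 M : R, 0 <= M & forall u, ell2_norm (T u) <= M * ell2_norm u.
Proof.
move=> [_ [M TM]]; exists (Num.max M 0); first by rewrite le_max lexx orbT.
move=> u; apply: le_trans (TM u) _.
by rewrite ler_wpM2r ?ell2_norm_ge0// le_max lexx.
Qed.

Lemma linear_fun0 T : linear T -> T 0 = 0.
Proof. by move=> Tl; have := Tl (-1) 0 0; rewrite scaleN1r oppr0 addr0 scaleN1r addNr. Qed.

Lemma linear_funB T u v : linear T -> T (u - v) = T u - T v.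
Proof. by move=> Tl; have := Tl (-1) v u; rewrite !scaleN1r ![- _ + _]addrC. Qed.

Lemma linear_funZ T a u : linear T -> T (a *: u) = a *: T u.
Proof. by move=> Tl; have := Tl a u 0; rewrite linear_fun0// !addr0. Qed.

(** As both operators are bounded, the supremum in [opnorm] is over a bounded set and dominates the
    value at the unit vector [delta R x]. *)
Lemma opnorm_delta T S y x (e : R) : bounded_operator T -> bounded_operator S ->
  opnorm (T - S) < e -> normc (T (delta R x) y - S (delta R x) y) <= e.
Proof.
move=> /bounded_ge0[M M0 TM] /bounded_ge0[N N0 SN] TSe.
apply: le_trans (ltW TSe).
have -> : T (delta R x) y - S (delta R x) y = ((T - S) (delta R x)) y by [].
apply: le_trans (normc_le_ell2_norm _ _) _; apply: ub_le_sup.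
  exists (2 * (M + N)) => _ [u /= u1 <-].
  apply: le_trans (ell2_normB_le _ _) _; rewrite ler_wpM2l//.
  by apply: lerD; [apply: le_trans (TM u) _|apply: le_trans (SN u) _];
    rewrite -[leRHS]mulr1 ler_wpM2l.
by exists (delta R x) => //=; rewrite delta_norm.
Qed.

End bounded.

Lemma le_esumZ (R : realType) (T : choiceType) (D : set T) (c : R) (h : T -> R) :
  0 <= c -> (forall x, 0 <= h x) ->
  (\esum_(x in D) (c * h x)%:E <= c%:E * \esum_(x in D) (h x)%:E)%E.
Proof.
move=> c0 h0; apply: ge_ereal_sup => _ [A [Afin AD] <-].
under eq_fsbigr do rewrite EFinM.
rewrite -ge0_mule_fsumr// lee_wpmul2l ?lee_fin//; apply: ereal_sup_ubound.
by exists A.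
Qed.

(** * Weighted translations along a partial bijection *)

Section weighted_translation.
Variables (R : realType) (X : choiceType) (k : X -> option X).
Hypothesis kI : forall y y' x, k y = Some x -> k y' = Some x -> y = y'.
Implicit Types (w : X -> R[i]) (u : ell2 R X).

(* The operator sending [delta x] to [w x *: delta y] whenever [k y = Some x]; its value
   is the junk 0 when the formula is not square summable, which needs [w] unbounded. *)
Definition weighted_translation_fun w (u : X -> R[i]^o) : X -> R[i]^o :=
  fun y => if k y is Some x then w x * u x else 0.

Definition weighted_translation w u : ell2 R X :=
  insubd 0 (weighted_translation_fun w u).

(** By [kI], replacing [y] by the [x] with [k y = Some x] is injective, so the sum over the domain
    of [k] becomes a sum over part of [X]. *)
Lemma esum_weighted_translation w u :
  (\esum_(y in [set: X]) (normc (weighted_translation_fun w u y) ^+ 2)%:E <=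
   \esum_(x in [set: X]) (normc (w x) ^+ 2 * normc (u x) ^+ 2)%:E)%E.
Proof.
pose D := [set y | isSome (k y)]; pose e y := odflt y (k y).
have n0 (z : R[i]) : 0 <= normc z ^+ 2 by rewrite exprn_ge0// normc_ge0.
rewrite (esumID D) => [|y _]; last by rewrite lee_fin.
rewrite setTI setTI [X in (_ + X)%E]esum1 ?adde0 => [|y]; last first.
  rewrite /D /weighted_translation_fun /=.
  by case: (k y) => // _; rewrite normc0 expr0n.
have -> : (\esum_(y in D) (normc (weighted_translation_fun w u y) ^+ 2)%:E =
    \esum_(y in D) (normc (w (e y)) ^+ 2 * normc (u (e y)) ^+ 2)%:E)%E.
  apply: eq_esum => y; rewrite /D /weighted_translation_fun /e /=.
  by case: (k y) => //= x _; rewrite normcM exprMn.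
rewrite -(@reindex_esum _ _ _ D (e @` D) e
  (fun x => (normc (w x) ^+ 2 * normc (u x) ^+ 2)%:E)).
  rewrite [leRHS](esumID (e @` D)) => [|x _]; last by rewrite lee_fin mulr_ge0.
  by rewrite setTI leeDl// esum_ge0// => x _; rewrite lee_fin mulr_ge0.
split=> [y Dy|y y'|//]; first by exists y.
rewrite !inE /D /e /=; case ky : (k y) => [x|//] _; case ky' : (k y') => [x'|//] _ /= xx'.
by apply: kI ky _; rewrite ky' xx'.
Qed.

Lemma weighted_translation_bound w u (C : R) : (forall x, normc (w x) <= C) ->
  (\esum_(x in [set: X]) (normc (w x) ^+ 2 * normc (u x) ^+ 2)%:E <=
   (C ^+ 2)%:E * \esum_(x in [set: X]) (normc (u x) ^+ 2)%:E)%E.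
Proof.
move=> wC; have n0 (z : R[i]) : 0 <= normc z ^+ 2 by rewrite exprn_ge0// normc_ge0.
apply: le_trans (le_esumZ _ (sqr_ge0 C) (fun x => n0 (u x))).
apply: le_esum => x _; rewrite lee_fin ler_wpM2r//.
have C0 := le_trans (normc_ge0 _) (wC x).
by rewrite ler_pXn2r ?nnegrE ?normc_ge0.
Qed.

Lemma weighted_translationE w u (C : R) y : (forall x, normc (w x) <= C) ->
  weighted_translation w u y = if k y is Some x then w x * u x else 0.
Proof.
move=> wC; rewrite /weighted_translation.
rewrite -[RHS]/(weighted_translation_fun w u y); congr (_ _).
apply: insubdK; apply/asboolP.
apply: le_lt_trans (esum_weighted_translation _ _) _.
apply: le_lt_trans (weighted_translation_bound _ wC) _.
by rewrite -ell2_normE -EFinM ltry.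
Qed.

(** The weights stay inside the sum, so that it can be split into a finite part, where [w] is small,
    and a tail, where [w] is merely bounded. *)
Lemma weighted_translation_norm w u (C : R) : (forall x, normc (w x) <= C) ->
  ((ell2_norm (weighted_translation w u) ^+ 2)%:E <=
   \esum_(x in [set: X]) (normc (w x) ^+ 2 * normc (u x) ^+ 2)%:E)%E.
Proof.
move=> wC; rewrite ell2_normE; apply: le_trans (esum_weighted_translation _ _).
by apply: le_esum => y _; rewrite (weighted_translationE _ _ wC).
Qed.

Lemma weighted_translation_linear w (C : R) : (forall x, normc (w x) <= C) ->
  linear (weighted_translation w).
Proof.
move=> wC a u v; apply: ell2_ext => y; rewrite ell2E !(weighted_translationE _ _ wC).
case: (k y) => [x|]; last by rewrite mulr0 addr0.
by rewrite ell2E mulrDr mulrCA.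
Qed.

Lemma weighted_translation_bounded w (C : R) : (forall x, normc (w x) <= C) ->
  bounded_operator (weighted_translation w).
Proof.
move=> wC; split; first exact: weighted_translation_linear wC.
exists `|C| => u; have wC' x : normc (w x) <= `|C| by apply: le_trans (wC x) (ler_norm _).
apply: ell2_norm_le; first by rewrite mulr_ge0// ell2_norm_ge0.
rewrite -ell2_normE; apply: le_trans (weighted_translation_norm _ wC') _.
by apply: le_trans (weighted_translation_bound _ wC') _; rewrite -ell2_normE -EFinM exprMn.
Qed.

Lemma weighted_translation_supp w (C : R) x y : (forall x, normc (w x) <= C) ->
  supp (weighted_translation w) (x, y) -> k y = Some x.
Proof.
move=> wC; rewrite /supp /= dot_deltar (weighted_translationE _ _ wC) /=.
case: (k y) => [z|]; last by rewrite eqxx.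
by case: (eqVneq z x) => [->//|]; rewrite mulr0 eqxx.
Qed.

End weighted_translation.

(** * Product topology and matrix coefficients *)

(** The sets of points agreeing with [t0] on finitely many coordinates generate a filter that
    converges to [t0] in each coordinate, hence in the product topology. *)
Lemma nbhs_ptws_finite (Y : choiceType) (T : topologicalType)
    (t0 : {ptws Y -> T}) (V : set {ptws Y -> T}) :
  nbhs t0 V -> exists S : seq Y, forall t : {ptws Y -> T},
    (forall y, y \in S -> t y = t0 y) -> V t.
Proof.
move=> t0V.
pose F := filter_from [set: seq Y] (fun S =>
  [set t : {ptws Y -> T} | forall y, y \in S -> t y = t0 y]).
have FF : Filter F.
  apply: filter_from_filter => [|S S' _ _]; first by exists [::].
  exists (S ++ S') => // t tS.
  by split=> y yS; apply: tS; rewrite mem_cat yS ?orbT.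
have Ft0 : F --> t0.
  apply/cvg_sup => y A [B [[W oW <-] Wt] BA].
  by exists [:: y] => // t ty; apply: BA; rewrite /= ty// mem_head.
by have [S _ SV] := Ft0 _ t0V; exists S => t /SV.
Qed.

Definition disk_val (R : realType) (Y : Type) (t : disk_power R Y) (y : Y) : R[i] :=
  set_val (t y).

Lemma normc_disk_val (R : realType) (Y : Type) (t : disk_power R Y) y :
  normc (disk_val t y) <= 1.
Proof. by have := set_valP (t y); rewrite /unit_disk /= lecR. Qed.

Lemma disk_val_near (R : realType) (Y : choiceType) (t0 : disk_power R Y) y (r : R) :
  0 < r -> \forall t \near t0, normc (disk_val t y - disk_val t0 y) < r.
Proof.
move=> r0; have rC0 : 0 < r%:C by rewrite ltcR.
have := @proj_continuous Y (fun=> @unit_disk R : topologicalType) y t0.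
move=> /(_ [set z | normc (set_val z - disk_val t0 y) < r]); apply.
have := @initial_continuous _ _ (@set_val _ (@unit_disk R)) (t0 y).
move=> /(_ [set z | normc (z - disk_val t0 y) < r]); apply.
have := nbhsx_ballx (disk_val t0 y : R[i]^o) _ rC0.
by apply: filterS => z; rewrite -ball_normE /ball_ /= ltcR -normcN opprB.
Qed.

Lemma disk_val_near_seq (R : realType) (X Y : choiceType) (f : X -> Y)
    (t0 : disk_power R Y) (s : seq X) (r : R) : 0 < r ->
  nbhs t0 [set t | forall x, x \in s -> normc (disk_val t (f x) - disk_val t0 (f x)) < r].
Proof.
move=> r0; elim: s => [|x s IHs]; first by apply: filterS filterT => t _ x; rewrite in_nil.
apply: filterS2 (disk_val_near t0 (f x) r0) IHs => t tx ts z.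
by rewrite inE => /predU1P[->//|/ts].
Qed.

Section roe.
Variables (R : realType) (X : choiceType) (E : set (set (X * X))).

Lemma algebraic_sub_uniform_Roe : algebraic_uniform_Roe E `<=` @uniform_Roe R X E.
Proof.
move=> T [Tb ET]; split=> // e e0; exists T; first by [].
rewrite subrr /opnorm (_ : [set _ | _ in _] = [set 0]) ?sup1//.
have n0 : ell2_norm (0 : ell2 R X) = 0.
  by rewrite /ell2_norm esum1 ?sqrtr0// => x _; rewrite normc0 expr0n.
by apply/seteqP; split=> [_ [u _ <-] //|_ ->]; exists 0; rewrite /= n0 ?ler01.
Qed.

(** The coefficients of a close approximant [S] vanish outside its support, which is an
    entourage. *)
Lemma uniform_Roe_coefficient T (e : R) : uniform_Roe E T -> 0 < e ->
  exists2 A, E A & forall x y, ~ A (x, y) -> normc (T (delta R x) y) <= e.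
Proof.
move=> [Tb TE] /TE[S [Sb ES] TSe]; exists (supp S) => // x y.
rewrite /supp /= dot_deltar => /negP; rewrite negbK => /eqP Sxy.
by have := opnorm_delta y x Tb Sb TSe; rewrite Sxy subr0.
Qed.

End roe.

(** For fixed [u], the translate of [u] depends continuously in norm on [t], even for coordinatewise
    convergence: the weights are bounded and [u] has little mass outside a finite set. *)
Lemma weighted_translation_coefficient_closed (R : realType) (X Y Z : choiceType)
    (k : X -> option X) (f : X -> Y) (U : ell2 R X -> ell2 R Z) u z (c : R) :
  (forall y y' x, k y = Some x -> k y' = Some x -> y = y') ->
  bounded_operator U ->
  closed [set t : disk_power R Y |
    normc (U (weighted_translation k (disk_val t \o f) u) z) <= c].
Proof.
move=> kI Ub t0 clt0 /=; apply/ler_addgt0Pr => e e0.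
have [M M0 UM] := bounded_ge0 Ub.
(* The added 1 allows for [M = 0]; [U] sends vectors of norm at most [d] to vectors of norm at most
   [e]. *)
pose d := e / (M + 1).
have M1 : 0 < M + 1 by rewrite ltr_wpDl.
have d0 : 0 < d by rewrite divr_gt0.
(* Two weights differ by at most 2, so the tail contributes at most 4 (d^2 / 8) = d^2 / 2 to the
   squared norm. *)
have [A Afin Au] := @ell2_norm_tail _ _ u (d ^+ 2 / 8) ltac:(by rewrite divr_gt0// exprn_gt0).
pose n := ell2_norm u ^+ 2.
have n0 : 0 <= n by rewrite sqr_ge0.
(* Squared weight differences below [r2] on [A] contribute at most [r2 * n], again at most d^2 /
   2. *)
pose r2 := d ^+ 2 / (2 * (n + 1)).
have r20 : 0 < r2 by rewrite divr_gt0 ?exprn_gt0// mulr_gt0// ltr_wpDl.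
have /finite_seqP[s As] := Afin.
have r0 : 0 < Num.sqrt r2 by rewrite sqrtr_gt0.
have [t [/= tc tt0]] := clt0 _ (disk_val_near_seq f t0 s r0).
pose w := fun x => disk_val t (f x) - disk_val t0 (f x).
have w2 x : normc (w x) <= 2.
  rewrite (le_trans (le_normcD _ _))// normcN -[leRHS]/(1 + 1 : R).
  by apply: lerD; exact: normc_disk_val.
have w1 (t1 : disk_power R Y) x : normc ((disk_val t1 \o f) x) <= 1 by exact: normc_disk_val.
have wT : weighted_translation k w u = weighted_translation k (disk_val t \o f) u -
    weighted_translation k (disk_val t0 \o f) u.
  apply: ell2_ext => x; rewrite (weighted_translationE kI u x w2).
  set a := weighted_translation k _ u; set b := weighted_translation k _ u.
  rewrite (_ : (a - b) x = a x - b x)// /a /b.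
  rewrite (weighted_translationE kI u x (w1 t)) (weighted_translationE kI u x (w1 t0)).
  case: (k x) => [x'|]; last by rewrite subr0.
  by rewrite mulrBl.
have wd : ell2_norm (weighted_translation k w u) <= d.
  suff : ((ell2_norm (weighted_translation k w u) ^+ 2)%:E <= (d ^+ 2)%:E)%E.
    by rewrite lee_fin ler_pXn2r ?nnegrE ?ell2_norm_ge0 ?(ltW d0).
  apply: le_trans (weighted_translation_norm kI _ w2) _.
  have m0 (a b : R[i]) : 0 <= normc a ^+ 2 * normc b ^+ 2.
    by rewrite mulr_ge0// exprn_ge0// normc_ge0.
  have u0 x : 0 <= normc (u x) ^+ 2 by rewrite exprn_ge0// normc_ge0.
  rewrite (esumID A) => [|x _]; last by rewrite lee_fin.
  rewrite !setTI (splitr (d ^+ 2)) EFinD; apply: leeD.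
    apply: (@le_trans _ _ (\esum_(x in A) (r2 * normc (u x) ^+ 2)%:E)%E).
      apply: le_esum => x; rewrite As => xs; rewrite lee_fin ler_wpM2r//.
      rewrite -(sqr_sqrtr (ltW r20)) ler_pXn2r ?nnegrE ?sqrtr_ge0 ?normc_ge0//.
      by apply: ltW; exact: tt0.
    apply: le_trans (le_esumZ _ (ltW r20) u0) _.
    apply: (@le_trans _ _ (r2%:E * n%:E)%E).
      rewrite lee_wpmul2l ?lee_fin ?(ltW r20)// ell2_normE [leRHS](esumID A).
        by rewrite setTI leeDl// esum_ge0// => x _; rewrite lee_fin.
      by move=> x _; rewrite lee_fin.
    rewrite -EFinM lee_fin (@le_trans _ _ (r2 * (n + 1)))//.
      by rewrite ler_wpM2l ?(ltW r20)// lerDl.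
    by rewrite /r2 invfM mulrA mulfVK// gt_eqF// ltr_wpDl.
  apply: (@le_trans _ _ (\esum_(x in ~` A) (4 * normc (u x) ^+ 2)%:E)%E).
    apply: le_esum => x _; rewrite lee_fin ler_wpM2r//.
    have -> : (4 : R) = 2 ^+ 2 by rewrite -natrX.
    by rewrite ler_pXn2r ?nnegrE ?normc_ge0.
  apply: le_trans (le_esumZ _ _ u0) _ => //.
  apply: (@le_trans _ _ (4%:E * (d ^+ 2 / 8)%:E)%E).
    by rewrite lee_wpmul2l ?lee_fin.
  by rewrite -EFinM lee_fin; lra.
have -> : U (weighted_translation k (disk_val t0 \o f) u) z =
  U (weighted_translation k (disk_val t \o f) u) z - U (weighted_translation k w u) z.
  rewrite wT linear_funB; last exact: Ub.1.
  set a := U _; set b := U _.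
  by rewrite (_ : (b - a) z = b z - a z)// opprB addrC subrK.
apply: le_trans (le_normcD _ _) _; rewrite normcN; apply: lerD => //.
apply: le_trans (normc_le_ell2_norm _ _) _; apply: le_trans (UM _) _.
apply: (@le_trans _ _ ((M + 1) * d)).
  by apply: ler_pM => //; rewrite ?ell2_norm_ge0// lerDl.
by rewrite /d mulrCA divff ?mulr1 ?gt_eqF.
Qed.

(** * Entourages from large coefficients *)

Lemma coarse_bigcup_seq (X : Type) (E : set (set (X * X))) (I : eqType) (s : seq I)
    (A : I -> set (X * X)) :
  coarse_structure E -> (forall i, i \in s -> E (A i)) ->
  E (\bigcup_(i in [set` s]) A i).
Proof.
move=> Ecs; elim: s => [|i s IHs] EA.
  by apply: (coarse_sub Ecs (coarse_diagonal Ecs)) => p [].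
apply: (coarse_sub Ecs (_ : E (A i `|` \bigcup_(i in [set` s]) A i))).
  apply: (coarse_setU Ecs); first by apply: EA; rewrite mem_head.
  by apply: IHs => j js; apply: EA; rewrite in_cons js orbT.
move=> p [j /=]; rewrite in_cons => /predU1P[->|js] Ajp; first by left.
by right; exists j.
Qed.

Section entourages.
Variables (R : realType) (X Y : choiceType).
Variables (E : set (set (X * X))) (F : set (set (Y * Y))).
Variables (U : ell2 R X -> ell2 R Y) (U' : ell2 R Y -> ell2 R X).
Hypotheses (Ecs : coarse_structure E) (Fcs : coarse_structure F).
Hypothesis Eulf : uniformly_locally_finite E.
Hypothesis Fsmall : small_coarse R F.
Hypothesis Ub : bounded_operator U.
Hypothesis UEF : forall T, uniform_Roe E T -> uniform_Roe F (U \o T \o U').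

(** The modulus of the (y, y') coefficient of the conjugate by [U] of the matrix unit sending
    [delta R x] to [delta R x']. *)
Definition coefficient (x x' : X) (y y' : Y) : R :=
  normc (U' (delta R y) x) * normc (U (delta R x') y').

(** The hypotheses make [P] the graph of an injective partial map with [f] injective on its domain,
    so each coordinate of [t] weights at most one pair of [P]. *)
Lemma partial_bijection_entourage (f : X -> Y) (P : set (X * X)) (eps : R) :
  E P -> 0 < eps ->
  (forall x y y', P (x, y) -> P (x, y') -> y = y') ->
  (forall x x' y, P (x, y) -> P (x', y) -> x = x') ->
  (forall x x' y y', P (x, y) -> P (x', y') -> f x = f x' -> x = x') ->
  exists2 Q, F Q & forall x x' y y',
    P (x, x') -> eps <= coefficient x x' y y' -> Q (y, y').
Proof.
move=> EP eps0 Pfun Pinj fP.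
have /choice[k kP] : forall y, exists o : option X, forall x, o = Some x <-> P (x, y).
  move=> y; have [[x Pxy]|nP] := pselect (exists x, P (x, y)).
    by exists (Some x) => x'; split=> [[<-]//|/(Pinj _ _ _ Pxy) ->].
  by exists None => x; split=> // Pxy; case: nP; exists x.
have kI y y' x : k y = Some x -> k y' = Some x -> y = y'.
  by move=> /kP Py /kP; exact: Pfun Py.
pose W (t : disk_power R Y) := weighted_translation k (disk_val t \o f).
have w1 (t : disk_power R Y) x : normc ((disk_val t \o f) x) <= 1.
  exact: normc_disk_val.
pose c (t : disk_power R Y) y y' := normc (U (W t (U' (delta R y))) y').
have eps3 : 0 < eps / 3 by rewrite divr_gt0.
(* Switching the coordinate [f x] from 1 to 0 removes exactly the matrix unit of (x, x') from
   [W t]. *)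
have c_single (t1 t2 : disk_power R Y) x x' y y' : P (x, x') ->
    (forall z, z != f x -> t1 z = t2 z) -> disk_val t1 (f x) = 1 -> disk_val t2 (f x) = 0 ->
    coefficient x x' y y' <= c t1 y y' + c t2 y y'.
  move=> Pxx' t12 t1x t2x; set v := U' (delta R y).
  have kx' : k x' = Some x by apply/kP.
  have Wv : W t1 v - W t2 v = v x *: delta R x'.
    apply: ell2_ext => z; transitivity (W t1 v z - W t2 v z); first by [].
    transitivity (v x * (z == x')%:R); last by [].
    rewrite (weighted_translationE kI v z (w1 t1)) (weighted_translationE kI v z (w1 t2)).
    have [->|zx'] := eqVneq z x'.
      by rewrite kx' /= t1x t2x mul1r mul0r subr0 mulr1.
    rewrite mulr0; case kz : (k z) => [x1|]; last by rewrite subr0.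
    have /kP Px1 := kz.
    rewrite /disk_val /= t12 ?subrr//; apply: contraNneq zx' => fx1.
    have x1x := fP _ _ _ _ Px1 Pxx' fx1; move: Px1; rewrite x1x => /Pfun Px.
    by rewrite (Px _ Pxx').
  rewrite /coefficient -normcM.
  have -> : v x * U (delta R x') y' = U (W t1 v) y' - U (W t2 v) y'.
    have := congr1 (fun u => U u y') Wv.
    by rewrite linear_funZ ?linear_funB; [move=> /esym| exact: Ub.1| exact: Ub.1].
  by apply: le_trans (le_normcD _ _) _; rewrite normcN.
pose C (A : set (Y * Y)) := [set t : disk_power R Y |
  forall y y', ~ A (y, y') -> c t y y' <= eps / 3].
have Ccl A : closed (C A).
  have -> : C A = \bigcap_(p in ~` A) [set t : disk_power R Y | c t p.1 p.2 <= eps / 3].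
    by apply/seteqP; split=> t Ct; [move=> [y y']; exact: Ct|move=> y y'; exact: (Ct (y, y'))].
  apply: closed_bigI => -[y y'] _.
  exact: weighted_translation_coefficient_closed kI Ub.
have Cmono A B : A `<=` B -> C A `<=` C B.
  by move=> AB t Ct y y' nB; apply: Ct => /AB.
have Ccov t : exists2 A, F A & C A t.
  have WE : uniform_Roe E (W t).
    apply: algebraic_sub_uniform_Roe; split.
      by have := weighted_translation_bounded kI (w1 t).
    apply: (coarse_sub Ecs EP) => -[x x'] /(weighted_translation_supp kI (w1 t)).
    by move=> /kP.
  by have [A FA AW] := uniform_Roe_coefficient (UEF WE) eps3; exists A.
have [A FA [t0 t0A]] := small_coarse_interior Fcs Fsmall Ccl Cmono Ccov.
have [S SA] := nbhs_ptws_finite t0A.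
(* For the finitely many coordinates [z] in [S], where [t0] cannot be changed freely, the pair to
   compare is [single z] and the zero point. *)
pose single z : disk_power R Y := fun z' => to_disk (z' == z)%:R.
have /choice[B BP] : forall z, exists B, F B /\ C B (single z).
  by move=> z; have [B] := Ccov (single z); exists B.
have [A0 FA0 A0P] := Ccov (fun=> to_disk 0).
exists (A `|` (A0 `|` \bigcup_(z in [set` S]) B z)).
  apply: (coarse_setU Fcs) => //; apply: (coarse_setU Fcs) => //.
  by apply: coarse_bigcup_seq => // z _; exact: (BP z).1.
move=> x x' y y' Pxx' cxx'; apply: contrapT => /not_orP[nA /not_orP[nA0 nB]].
(* Such a pair would give eps <= 2 eps / 3. *)
suff [t1 [t2 [t12 t1x t2x ct]]] : exists t1 t2 : disk_power R Y,
    [/\ forall z, z != f x -> t1 z = t2 z, disk_val t1 (f x) = 1,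
        disk_val t2 (f x) = 0 & c t1 y y' + c t2 y y' <= eps / 3 + eps / 3].
  have := le_trans cxx' (le_trans (c_single _ _ _ _ _ _ Pxx' t12 t1x t2x) ct).
  by lra.
have [fxS|fxS] := boolP (f x \in S).
  exists (single (f x)), (fun=> to_disk 0); split.
  - by move=> z /negPf; rewrite /single => ->.
  - by rewrite /disk_val /single eqxx to_diskK// normr1.
  - by rewrite /disk_val to_diskK// normr0.
  - apply: lerD; last exact: A0P.
    by apply: (BP (f x)).2 => Bfx; apply: nB; exists (f x).
pose t (a : R[i]) : disk_power R Y := fun z => if z == f x then to_disk a else t0 z.
have tA a : C A (t a).
  by apply: SA => z zS; rewrite /t; case: eqVneq => // zfx; rewrite -zfx zS in fxS.
exists (t 1), (t 0); split.
- by move=> z /negPf; rewrite /t => ->.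
- by rewrite /disk_val /t eqxx to_diskK// normr1.
- by rewrite /disk_val /t eqxx to_diskK// normr0.
- by apply: lerD; exact: tA.
Qed.

Lemma bounded_fibres_entourage (f : X -> Y) m (P : set (X * X)) (eps : R) :
  (forall y, [set x | f x = y] #<= `I_m) -> E P -> 0 < eps ->
  exists2 Q, F Q & forall x x' y y',
    P (x, x') -> eps <= coefficient x x' y y' -> Q (y, y').
Proof.
move=> fm EP eps0.
have [n Pn] := Eulf EP; have [n' Pn'] := Eulf (coarse_inv Ecs EP).
(* [c x] numbers the [y] with [P (x, y)], [c' y] the [x] with [P (x, y)], and [d y] the fibre of [f]
   over [y], all injectively and with uniform bounds. *)
have /choice[c cP] := fun x => card_le_inj (inhabits 0%N) (Pn x).
have /choice[c' c'P] := fun x => card_le_inj (inhabits 0%N) (Pn' x).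
have /choice[d dP] := fun y => card_le_inj (inhabits 0%N) (fm y).
(* The three colours make each piece of [P] a graph, an injection, and a relation on whose
   domain [f] is injective. *)
pose label (p : X * X) := (c p.1 p.2, c' p.2 p.1, d (f p.1) p.1).
have /choice[Q QP] : forall i, exists Q, F Q /\ forall x x' y y',
    P (x, x') -> label (x, x') = i -> eps <= coefficient x x' y y' -> Q (y, y').
  move=> i; have [|//|x y y'|x x' y|x x' y y'|Q FQ QP] :=
    @partial_bijection_entourage f [set p | P p /\ label p = i] eps.
  - by apply: (coarse_sub Ecs EP) => p [].
  - move=> [Py <-] [Py' /esym[cy _]]; exact: ((cP x).2 _ _ (mem_set Py) (mem_set Py') cy).
  - move=> [Px <-] [Px' /esym[_ c'x _]]; exact: ((c'P y).2 _ _ (mem_set Px) (mem_set Px') c'x).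
  - move=> [Px <-] [Px' /esym[_ _ dx]] fx;
    apply: ((dP (f x)).2 _ _ (mem_set erefl) (mem_set (esym fx))).
    by rewrite dx fx.
  by exists Q; split=> // x x' y y' Px Pi; exact: QP.
pose s := [seq (p, l) | p <- [seq (i, j) | i <- iota 0 n, j <- iota 0 n'], l <- iota 0 m].
exists (\bigcup_(i in [set` s]) Q i).
  by apply: coarse_bigcup_seq => // i _; exact: (QP i).1.
move=> x x' y y' Px cxx'; exists (label (x, x')); last exact: (QP _).2 cxx'.
apply: allpairs_f; first apply: allpairs_f; rewrite mem_iota /= add0n.
- exact: (cP x).1.
- exact: (c'P x').1.
- exact: (dP (f x)).1.
Qed.

End entourages.

(** * Maps chosen by rigidity and the coarse equivalence *)

Lemma card_le_II_seq (T : choiceType) (A : set T) n :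
  (forall s : seq T, uniq s -> (forall x, x \in s -> A x) -> (size s <= n)%N) ->
  A #<= `I_n.
Proof.
move=> An; have [Afin|/(@infinite_set_fset _ _ n.+1)[B BA nB]] := pselect (finite_set A).
  have [s [us As]] : exists s : seq T, uniq s /\ A = [set` s].
    have /finite_seqP[s ->] := Afin; exists (undup s); rewrite undup_uniq; split=> //.
    by apply/seteqP; split=> x /=; rewrite mem_undup.
  have sn : (size s <= n)%N by apply: An => // x; rewrite As.
  have [h] : $|{injfun A >-> `I_n}|.
    apply/injfunPex; exists (index^~ s) => [x|x y].
      by rewrite As /= => xs; apply: leq_trans sn; rewrite index_mem.
    by rewrite !inE As /= => xs ys; exact: index_inj.
  exact: inj_card_le h.
have := An _ (fset_uniq B) (fun x xB => BA x xB).
by rewrite leqNgt nB.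
Qed.

Lemma adjoint_coefficient (R : realType) (X Y : choiceType)
    (U : ell2 R X -> ell2 R Y) (U' : ell2 R Y -> ell2 R X) x y : is_adjoint U U' ->
  normc (U' (delta R y) x) = normc (U (delta R x) y).
Proof. by move=> UU'; rewrite -normc_conj -dot_deltal -UU'.2 dot_deltar. Qed.

(** Each point of the fibre over [y] contributes at least d^2 to the squared norm of
    [U (delta R y)], which is at most M^2. *)
Lemma large_coefficient_fibres (R : realType) (X Y : choiceType)
    (U : ell2 R Y -> ell2 R X) (f : X -> Y) (d : R) : bounded_operator U ->
  0 < d -> (forall x, d < normc (U (delta R (f x)) x)) ->
  exists m, forall y, [set x | f x = y] #<= `I_m.
Proof.
move=> Ub d0 fd; have [M M0 UM] := bounded_ge0 Ub.
exists (Num.bound (M ^+ 2 / d ^+ 2)) => y; apply: card_le_II_seq => s us sy.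
suff : (size s)%:R < (Num.bound (M ^+ 2 / d ^+ 2))%:R :> R by rewrite ltr_nat => /ltnW.
apply: le_lt_trans (archi_boundP _); last by rewrite divr_ge0// sqr_ge0.
rewrite ler_pdivlMr ?exprn_gt0//.
apply: (@le_trans _ _ (\sum_(x <- s) normc (U (delta R y) x) ^+ 2)).
  have -> : (size s)%:R * d ^+ 2 = \sum_(x <- s) d ^+ 2.
    by rewrite big_const_seq count_predT iter_addr_0 mulr_natl.
  rewrite big_seq [leRHS]big_seq; apply: ler_sum => x /sy <-.
  by rewrite ler_pXn2r ?nnegrE ?normc_ge0 ?ltW.
apply: le_trans (sum_normc_le_ell2_norm _ us) _.
rewrite ler_pXn2r ?nnegrE ?ell2_norm_ge0//.
by apply: le_trans (UM _) _; rewrite delta_norm mulr1.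
Qed.

Lemma inf_sup_gt0 (R : realType) (X Y : choiceType) (c : X -> Y -> R) :
  (0 < ereal_inf (range (fun x => ereal_sup (range (fun y => (c x y)%:E)))))%E ->
  exists d : R, exists f : X -> Y, 0 < d /\ forall x, d < c x (f x).
Proof.
set a := ereal_inf _ => a0.
have [d [d0 da]] : exists d : R, 0 < d /\ (d%:E < a)%E.
  (* The infimum is +oo when [X] is empty, for instance; any positive [d] then works. Otherwise half
     the infimum leaves the strict gap needed to pick [y] even if a supremum is not attained. *)
  case: a a0 => [r|_|//]; last by exists 1; rewrite ltr01 ltry.
  rewrite lte_fin => r0; exists (r / 2).
  by rewrite divr_gt0// lte_fin ltr_pdivrMr// ltr_pMr// ltr1n.
have /choice[f fP] : forall x, exists y, d < c x y.
  move=> x; have /(lt_le_trans da) : (a <= ereal_sup (range (fun y => (c x y)%:E)))%E.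
    by apply: ereal_inf_lbound; exists x.
  by move=> /ereal_sup_gt[_ [y _ <-]]; rewrite lte_fin; exists y.
by exists d, f.
Qed.

Theorem theorem4p12 (R : realType) (X Y : choiceType)
    (E : set (set (X * X))) (F : set (set (Y * Y))) :
  coarse_structure E -> coarse_structure F ->
  uniformly_locally_finite E -> uniformly_locally_finite F ->
  small_coarse R E -> small_coarse R F ->
  rigidly_isomorphic R E F ->
  coarsely_equivalent E F.
Proof.
move=> Ecs Fcs Eulf Fulf Esmall Fsmall.
move=> [U [U' [[Ub UU' U'U UU'1] [phi _ _ _]]]].
move=> /inf_sup_gt0[d [f [d0 fd]]] /inf_sup_gt0[d' [g [d'0 gd']]].
have adj x y : normc (U' (delta R y) x) = normc (U (delta R x) y).
  exact: adjoint_coefficient.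
have {}fd x : d < normc (U (delta R x) (f x)) by have := fd x; rewrite dot_deltar.
have {}gd' y : d' < normc (U' (delta R y) (g y)) by have := gd' y; rewrite dot_deltar.
have roeUF T : uniform_Roe E T -> uniform_Roe F (U \o T \o U').
  by have [phi_fun _ _] := phi; exact: phi_fun.
(* Surjectivity of conjugation by [U] writes [S] as the conjugate of some [T] in the Roe algebra of
   [X], and conjugating back returns [T]. *)
have roeUE S : uniform_Roe F S -> uniform_Roe E (U' \o S \o U).
  have [_ _ phi_surj] := phi => /phi_surj[T ET <-].
  rewrite (_ : U' \o _ \o U = T)//; apply/funext => u /=.
  by have U'U1 := fun v => congr1 (@^~ v) U'U; rewrite !(U'U1 _ : U' (U _) = _).
have [m fm] : exists m, forall y, [set x | f x = y] #<= `I_m.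
  by apply: (large_coefficient_fibres UU'.1 d0) => x; rewrite adj.
have [m' gm] : exists m, forall x, [set y | g y = x] #<= `I_m.
  by apply: (large_coefficient_fibres Ub d'0) => y; rewrite -adj.
have fwd e eps := @bounded_fibres_entourage _ _ _ _ _ U U' Ecs Fcs Eulf Fsmall Ub roeUF
  f m e eps fm.
have bwd e eps := @bounded_fibres_entourage _ _ _ _ _ U' U Fcs Ecs Fulf Esmall UU'.1 roeUE
  g m' e eps gm.
have le_coef (a b p q : R) : 0 < a -> 0 < b -> a < p -> b < q -> a * b <= p * q.
  by move=> a0 b0 ap bq; apply: ler_pM; exact: ltW.
exists f; split.
  move=> e /fwd/(_ (mulr_gt0 d0 d0))[Q FQ QP]; exists Q => // x x' exx'.
  by apply: QP exx' _; apply: le_coef => //; rewrite adj.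
exists g; split.
- move=> e /bwd/(_ (mulr_gt0 d'0 d'0))[Q EQ QP]; exists Q => // y y' eyy'.
  by apply: QP eyy' _; apply: le_coef => //; rewrite -adj.
(* For the diagonal pair (f x, f x), the coefficient at (g (f x), x) is the product of the modulus
   bounded below by [d'] at [f x] and the one bounded below by [d] at [x]. *)
- have [Q EQ QP] := bwd _ _ (coarse_diagonal Fcs) (mulr_gt0 d'0 d0).
  apply: (coarse_sub Ecs EQ) => _ [x _ <-].
  by apply: (QP (f x) (f x)) => //; apply: le_coef => //; rewrite -?adj// adj.
- have [Q FQ QP] := fwd _ _ (coarse_diagonal Ecs) (mulr_gt0 d0 d'0).
  apply: (coarse_sub Fcs FQ) => _ [y _ <-].
  by apply: (QP (g y) (g y)) => //; apply: le_coef => //; rewrite ?adj// -adj.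
Qed.
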